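(* Let $P$ be a program and let $B$ be a set of pattern rules that is correct w.r.t. $P$. Suppose that $\mathit{patunf}(P,B)$ contains a pattern rule of the form $((u,(\sigma,\mu)),(u\sigma^a,(\sigma^b\sigma',\mu\mu')))$, where $a,b\in\mathbb N$, $u\in T(\Sigma,X)$, $\sigma,\mu,\sigma',\mu'\in S(\Sigma,X)$ and $\sigma'$ commutes with $\sigma$ and with $\mu$. Then for all $n\in\mathbb N$ and all $\theta\in S(\Sigma,X)$ there is an infinite $\Rightarrow_P$-chain that starts from $\langle u\sigma^n\mu\theta\rangle$.
   Context: Fix a signature $\Sigma$, a special constant $\mathsf{e}$ (also denoting the empty sequence) and an infinite countable set $X$ of variables, pairwise disjoint. $T(\Sigma,X)$ is the set of terms, $S(\Sigma,X)$ the set of substitutions (maps $X\to T(\Sigma,X)$ moving finitely many variables); composition $x(\sigma\theta)=(x\sigma)\theta$; $\emptyset$ is the identity substitution, $\sigma^0=\emptyset$, $\sigma^{n+1}=\sigma^n\sigma$; $\mathsf{e}\theta=\mathsf{e}$. $\sigma$ commutes with $\theta$ if $x\sigma\theta=x\theta\sigma$ for all $x\in X$. A renaming is a substitution that is a bijection on $X$; $\mathit{mgu}$ is the set of most general unifiers (componentwise on finite sequences). $\mathit{Var}(\sigma)$ is the set of variables in the domain or in the images of the domain. A program is a set of rules $(u,\bar v)$ ($u$ a term, $\bar v$ a finite sequence of terms written $\langle\dots\rangle$, juxtaposition being concatenation); binary rules have $\bar v$ of length $\le1$, written $(u,v)$ with $v\in T(\Sigma,X)\cup\{\mathsf{e}\}$.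 $[r]$ is the set of renamings of a rule $r$, $[U]=\bigcup_{r\in U}[r]$; $\bar r\ll_S U$ means $\bar r$ is a sequence of elements of $U$ variable disjoint from $S$ and from each other. For a rule $r$, $\Rightarrow_r=\{(\langle s\rangle\bar s,(\bar v\,\bar s)\theta)\mid\langle(u,\bar v)\rangle\ll_{\langle s\rangle\bar s}[r],\ \theta\in\mathit{mgu}(u,s)\}$ and $\Rightarrow_P=\bigcup_{r\in P}\Rightarrow_r$; a $\Rightarrow_P$-chain is a sequence of finite term sequences with consecutive elements related by $\Rightarrow_P$. Let $\mathit{id}$ be the set of rules $(\mathsf{f}(x_1,\dots,x_m),\mathsf{f}(x_1,\dots,x_m))$, $\mathsf{f}\in\Sigma$ of arity $m$, $x_i$ distinct variables. For a set $U$ of binary rules, $T_P^\beta(U)=[\{(u,\mathsf{e})\in P\}]\cup[\{(u\theta,v\theta)\mid r=(u,\langle v_1,\dots,v_m\rangle)\in P,\ 1\le i\le m,\ \langle(u_1,\mathsf{e}),\dots,(u_{i-1},\mathsf{e}),(u_i,v)\rangle\ll_r U\cup\mathit{id},\ v\neq\mathsf{e}\text{ if }i<m,\ \theta\in\mathit{mgu}(\langle u_1,\dots,u_i\rangle,\langle v_1,\dots,v_i\rangle)\}]$; $\mathit{binunf}(P)=\bigcup_{n\in\mathbb N}(T_P^\beta)^n(\emptyset)$. A pattern substitution is a pair $(\sigma,\mu)$ of substitutions, with $(\sigma,\mu)(n)=\sigma^n\mu$. A pattern term is $p=(s,(\sigma,\mu))$ with $s\in T(\Sigma,X)\cup\{\mathsf{e}\}$,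 $p(n)=s\sigma^n\mu$, $\mathit{Var}(p)=\mathit{Var}(s)\cup\mathit{Var}(\sigma)\cup\mathit{Var}(\mu)$; $\widehat{s}=(s,(\emptyset,\emptyset))$. A pattern rule is a pair $r=(p,q)$ of pattern terms, $\mathit{Var}(r)=\mathit{Var}(p)\cup\mathit{Var}(q)$, $\mathit{rules}(r)=\{(p(n),q(n))\mid n\in\mathbb N\}$; it is correct w.r.t. $P$ if $\mathit{rules}(r)\subseteq\mathit{binunf}(P)$, and a set of pattern rules is correct if all its elements are. A pattern substitution $\theta$ is an mgu of two equal-length sequences of pattern terms if for every $n$, $\theta(n)$ is an mgu of the corresponding sequences of $n$-th instances. For a pattern rule $r$, $[r]=\{r'\mid\mathit{rules}(r')\subseteq[\mathit{rules}(r)]\}$, $[U]=\bigcup_{r\in U}[r]$; $\ll_r$ is extended to pattern rules via the variable sets above. $\mathit{patid}$ is the set of pattern rules $(\widehat{\mathsf{f}(x_1,\dots,x_m)},\widehat{\mathsf{f}(x_1,\dots,x_m)})$. For sets $B,U$ of pattern rules, $T^\pi_{P,B}(U)=[B]\cup[\{((u,(\sigma,\mu)),(v,(\sigma_i\sigma,\mu_i\mu)))\mid r=(u,\langle v_1,\dots,v_m\rangle)\in P,\ 1\le i\le m,\ \langle(p_1,\widehat{\mathsf{e}}),\dots,(p_{i-1},\widehat{\mathsf{e}}),(p_i,(v,(\sigma_i,\mu_i)))\rangle\ll_r U\cup\mathit{patid},\ v\neq\mathsf{e}\text{ if }i<m,\ (\sigma,\mu)\text{ an mgu of }\langle p_1,\dots,p_i\rangle\text{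 and }\langle\widehat{v_1},\dots,\widehat{v_i}\rangle,\ \sigma\text{ commutes with }\sigma_i\text{ and }\mu_i\}]$, and $\mathit{patunf}(P,B)=\bigcup_{n\in\mathbb N}(T^\pi_{P,B})^n(\emptyset)$. *)

(* Defs.v *)
From mathcomp Require Import all_boot.
From mathcomp Require Import boolp classical_sets functions cardinality.
From Stdlib Require List.
Set Implicit Arguments.
Unset Strict Implicit.
Unset Printing Implicit Defensive.
Local Open Scope classical_set_scope.

Record signature := Signature { symbol :> Type; arity : symbol -> nat }.

Section Terms.
Context {Sg : signature} {X : countType}.

Inductive term : Type :=
| TVar of X
| App (f : Sg) of ('I_(arity f) -> term).

(* T(Sigma, X) extended with the special constant e, represented by [None]. *)
Definition eterm := option term.

Fixpoint tvars (t : term) : set X :=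
  match t with
  | TVar x => [set x]
  | App f a => [set x | exists i, tvars (a i) x]
  end.

Definition evars (t : eterm) : set X := if t is Some t' then tvars t' else set0.

Definition svars (s : seq term) : set X := [set x | List.Exists (tvars^~ x) s].

Record subst := Subst {
  sfun :> X -> term;
  sfun_finite : finite_set [set x | sfun x <> TVar x] }.

Definition sdom (s : subst) : set X := [set x | s x <> TVar x].

Definition subst_vars (s : subst) : set X :=
  sdom s `|` \bigcup_(x in sdom s) tvars (s x).

Fixpoint tsub (t : term) (s : subst) : term :=
  match t with
  | TVar x => s x
  | App f a => App (fun i => tsub (a i) s)
  end.

Definition esub (t : eterm) (s : subst) : eterm := omap (tsub^~ s) t.

Definition seqsub (ts : seq term) (s : subst) : seq term := map (tsub^~ s) ts.

Definition eseqsub (ts : seq eterm) (s : subst) : seq eterm := map (esub^~ s) ts.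

Lemma sid_finite : finite_set [set x | TVar x <> TVar x].
Proof. by apply: (sub_finite_set _ (finite_set0 X)) => x []. Qed.

Definition sid : subst := Subst sid_finite.

Lemma scomp_finite (s t : subst) : finite_set [set x | tsub (s x) t <> TVar x].
Proof.
apply: (@sub_finite_set _ _ (sdom s `|` sdom t)); last first.
  by rewrite finite_setU; split; exact: sfun_finite.
move=> x /= stx; case: (pselect (s x = TVar x)) => [sx|]; last by left.
by right; rewrite sx in stx.
Qed.

(* Diagrammatic order: x (s t) = (x s) t. *)
Definition scomp (s t : subst) : subst := Subst (scomp_finite s t).

Fixpoint spow (s : subst) (n : nat) : subst :=
  if n is m.+1 then scomp (spow s m) s else sid.

Definition commutes (s t : subst) : Prop :=
  forall x, tsub (s x) t = tsub (t x) s.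

Definition is_renaming (s : subst) : Prop :=
  exists2 f : X -> X, bijective f & forall x, s x = TVar (f x).

(* Most general unifiers of two objects of a type [A] on which substitutions
   act through [act]. *)
Definition mgu (A : Type) (act : A -> subst -> A) (a b : A) : set subst :=
  [set s | act a s = act b s /\
     forall t : subst, act a t = act b t ->
       exists d : subst, forall x, t x = scomp s d x].

(* [apart vars V U rs] is rs <<_V U, where [vars] gives the variables of the
   elements of [U]. *)
Definition apart (A : Type) (vars : A -> set X) (V : set X) (U : set A)
    (rs : seq A) : Prop :=
  [/\ List.Forall U rs,
      List.Forall (fun r => vars r `&` V = set0) rs &
      List.ForallOrdPairs (fun r r' => vars r `&` vars r' = set0) rs].

Definition rule := (term * seq term)%type.

Definition program := set rule.

Definition rule_sub (r : rule) (s : subst) : rule := (tsub r.1 s, seqsub r.2 s).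

Definition rule_vars (r : rule) : set X := tvars r.1 `|` svars r.2.

Definition rule_renamings (r : rule) : set rule :=
  [set r' | exists2 g, is_renaming g & r' = rule_sub r g].

Variant step_rule (r : rule) : seq term -> seq term -> Prop :=
| StepRule s ss u vs th of
    apart rule_vars (svars (s :: ss)) (rule_renamings r) [:: (u, vs)]
  & mgu tsub u s th :
    step_rule r (s :: ss) (seqsub (vs ++ ss) th).

Definition step (P : program) (s t : seq term) : Prop :=
  exists2 r, P r & step_rule r s t.

Definition infinite_chain_from (P : program) (s : seq term) : Prop :=
  exists2 c : nat -> seq term, c 0 = s & forall k, step P (c k) (c k.+1).

(* Binary rules; a right-hand side [None] is the empty sequence e. *)
Definition brule := (term * eterm)%type.

Definition brule_sub (r : brule) (s : subst) : brule := (tsub r.1 s, esub r.2 s).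

Definition brule_vars (r : brule) : set X := tvars r.1 `|` evars r.2.

Definition brule_renamings (U : set brule) : set brule :=
  [set r' | exists2 r, U r & exists2 g, is_renaming g & r' = brule_sub r g].

Definition id_rules : set brule :=
  [set r | exists (f : Sg) (x : 'I_(arity f) -> X), injective x /\
     r = (App (fun i => TVar (x i)), Some (App (fun i => TVar (x i))))].

Variant Tbeta_unfold (P : program) (U : set brule) : set brule :=
| TbetaUnfold u vs i us ui v th of
    P (u, vs) & 0 < i <= size vs & size us = i.-1
  & apart brule_vars (rule_vars (u, vs)) (U `|` id_rules)
      (rcons [seq (w, None) | w <- us] (ui, v))
  & (i < size vs -> v <> None)
  & mgu seqsub (rcons us ui) (take i vs) th :
    Tbeta_unfold P U (tsub u th, esub v th).

Definition Tbeta (P : program) (U : set brule) : set brule :=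
  brule_renamings [set r | exists2 u, P (u, [::]) & r = (u, None)]
  `|` brule_renamings (Tbeta_unfold P U).

Definition binunf (P : program) : set brule :=
  \bigcup_(n in [set: nat]) iter n (Tbeta P) set0.

Definition psubst := (subst * subst)%type.

Definition psubst_at (th : psubst) (n : nat) : subst :=
  scomp (spow th.1 n) th.2.

Definition pterm := (eterm * psubst)%type.

Definition pterm_at (p : pterm) (n : nat) : eterm := esub p.1 (psubst_at p.2 n).

Definition pterm_vars (p : pterm) : set X :=
  evars p.1 `|` subst_vars p.2.1 `|` subst_vars p.2.2.

Definition hat (s : eterm) : pterm := (s, (sid, sid)).

Definition prule := (pterm * pterm)%type.

Definition prule_vars (r : prule) : set X := pterm_vars r.1 `|` pterm_vars r.2.

(* The left component of a pattern rule may have e as its base term, so the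
   instances are pairs of elements of T(Sigma, X) extended with e. *)
Definition prule_rules (r : prule) : set (eterm * eterm) :=
  [set w | exists n, w = (pterm_at r.1 n, pterm_at r.2 n)].

Definition prule_correct (P : program) (r : prule) : Prop :=
  prule_rules r `<=` [set w | exists2 b, binunf P b & w = (Some b.1, b.2)].

Definition correct (P : program) (B : set prule) : Prop :=
  forall r, B r -> prule_correct P r.

Definition epair_renamings (U : set (eterm * eterm)) : set (eterm * eterm) :=
  [set w' | exists2 w, U w &
     exists2 g, is_renaming g & w' = (esub w.1 g, esub w.2 g)].

Definition prule_renamings (U : set prule) : set prule :=
  [set r' | exists2 r, U r & prule_rules r' `<=` epair_renamings (prule_rules r)].

Definition pmgu (ps qs : seq pterm) : set psubst :=
  [set th | size ps = size qs /\
     forall n, mgu eseqsub [seq pterm_at p n | p <- ps]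
                 [seq pterm_at q n | q <- qs] (psubst_at th n)].

Definition patid : set prule :=
  [set r | exists (f : Sg) (x : 'I_(arity f) -> X), injective x /\
     r = (hat (Some (App (fun i => TVar (x i)))),
          hat (Some (App (fun i => TVar (x i)))))].

Variant Tpi_unfold (P : program) (U : set prule) : set prule :=
| TpiUnfold u vs i ps pi v si mi s m of
    P (u, vs) & 0 < i <= size vs & size ps = i.-1
  & apart prule_vars (rule_vars (u, vs)) (U `|` patid)
      (rcons [seq (p, hat None) | p <- ps] (pi, (v, (si, mi))))
  & (i < size vs -> v <> None)
  & pmgu (rcons ps pi) [seq hat (Some w) | w <- take i vs] (s, m)
  & commutes s si & commutes s mi :
    Tpi_unfold P U ((Some u, (s, m)), (v, (scomp si s, scomp mi m))).

Definition Tpi (P : program) (B U : set prule) : set prule :=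
  prule_renamings B `|` prule_renamings (Tpi_unfold P U).

Definition patunf (P : program) (B : set prule) : set prule :=
  \bigcup_(n in [set: nat]) iter n (Tpi P B) set0.

End Terms.

Arguments term : clear implicits.
Arguments subst : clear implicits.
Arguments rule : clear implicits.
Arguments program : clear implicits.
Arguments prule : clear implicits.

(* Main.v *)
Require Import Defs.
From mathcomp Require Import all_boot.
From mathcomp Require Import boolp classical_sets functions cardinality.
From Stdlib Require Import Eqdep Relations.
From Stdlib Require List.
Set Implicit Arguments.
Unset Strict Implicit.
Unset Printing Implicit Defensive.
Local Open Scope classical_set_scope.

(** Let an instance step replace the head [u theta] of a goal by the instance
    [vs theta] of the body of a program rule [(u, vs)], for an arbitrary
    [theta].  A binary rule [(u, v)] is sound if every instance [u theta] in
    head position leads, by instance steps, to [v theta] in head position;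
    since no generality of unifiers and no renaming apart is involved, the
    elements of binunf, and then those of patunf, are sound by a direct
    induction.  By commutation the [n]-th instance of the given pattern rule
    leads from [u sigma^n mu] to an instance of [u sigma^(a + b n) mu], so that
    instance steps go on forever from every instance of [u sigma^n mu].  Such
    an infinite run lifts to an infinite chain, because an instance step from
    an instance of a goal is an instance of a step from that goal. *)

(** * Algebra of substitutions and their variables *)

Section Substitutions.
Context {Sg : signature} {X : countType}.
Implicit Types (t r : term Sg X) (s d : subst Sg X) (ts : seq (term Sg X)).

Lemma eq_subst s d : s =1 d -> s = d.
Proof.
case: s => s fs; case: d => d fd /= /funext sd.
by case: d / sd fd => fd; rewrite (Prop_irrelevance fs fd).
Qed.

Lemma eq_tsub t s d : (forall x, tvars t x -> s x = d x) -> tsub t s = tsub t d.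
Proof.
elim: t => [x|f a IH] /= sd; first exact: sd.
by congr App; apply: funext => i; apply: IH => x tx; apply: sd; exists i.
Qed.

Lemma tsub_scomp t s d : tsub t (scomp s d) = tsub (tsub t s) d.
Proof. by elim: t => [x|f a IH] //=; congr App; apply: funext. Qed.

Lemma tsub_sid t : tsub t sid = t.
Proof. by elim: t => [x|f a IH] //=; congr App; apply: funext. Qed.

Lemma esub_scomp (t : option (term Sg X)) s d :
  esub t (scomp s d) = esub (esub t s) d.
Proof. by case: t => //= t; rewrite tsub_scomp. Qed.

Lemma seqsub_scomp ts s d : seqsub ts (scomp s d) = seqsub (seqsub ts s) d.
Proof. by rewrite /seqsub -map_comp; apply: eq_map => t /=; rewrite tsub_scomp. Qed.

Lemma seqsub_sid ts : seqsub ts sid = ts.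
Proof. by rewrite -[RHS]map_id; apply: eq_map => t; rewrite tsub_sid. Qed.

Lemma scompA s d e : scomp s (scomp d e) = scomp (scomp s d) e.
Proof. by apply: eq_subst => x /=; rewrite tsub_scomp. Qed.

Lemma scomp1s s : scomp sid s = s.
Proof. exact: eq_subst. Qed.

Lemma scomps1 s : scomp s sid = s.
Proof. by apply: eq_subst => x /=; rewrite tsub_sid. Qed.

Lemma commutesP s d : commutes s d <-> scomp s d = scomp d s.
Proof. by split=> [sd|sd x]; [exact: eq_subst | rewrite -[LHS]/(scomp s d x) sd]. Qed.

Lemma commutes_sym s d : commutes s d -> commutes d s.
Proof. by move=> sd x; rewrite sd. Qed.

Lemma commutes_spow s d n : commutes s d -> commutes (spow s n) d.
Proof.
move=> /commutesP sd; apply/commutesP.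
elim: n => [|n IH] /=; first by rewrite scomp1s scomps1.
by rewrite -scompA sd scompA IH -scompA.
Qed.

Lemma spow_scomp s d n : commutes s d ->
  spow (scomp s d) n = scomp (spow s n) (spow d n).
Proof.
move=> sd; elim: n => [|n IH] /=; first by rewrite scomp1s.
have /commutesP ds := commutes_spow n (commutes_sym sd).
by rewrite IH -!scompA; congr scomp; rewrite !scompA ds.
Qed.

Lemma spowD s m n : spow s (m + n) = scomp (spow s m) (spow s n).
Proof.
elim: n => [|n IH]; first by rewrite addn0 scomps1.
by rewrite addnS /= IH scompA.
Qed.

Lemma spowM s m n : spow s (m * n) = spow (spow s m) n.
Proof. by elim: n => [|n IH]; rewrite ?muln0 // mulnSr spowD IH. Qed.

Lemma spow_sid n : spow (@sid Sg X) n = sid.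
Proof. by elim: n => //= n ->; rewrite scomps1. Qed.

Lemma finite_tvars t : finite_set (tvars t).
Proof.
elim: t => [x|f a IH] /=; first exact: finite_set1.
have -> : [set x | exists i, tvars (a i) x] = \bigcup_i tvars (a i).
  by apply/seteqP; split=> x [i ?]; exists i.
by apply: bigcup_finite => // ; exact: finite_finset.
Qed.

Lemma finite_svars ts : finite_set (svars ts).
Proof.
elim: ts => [|t ts IH].
  by apply: (sub_finite_set _ (finite_set0 X)) => x /List.Exists_nil.
apply: (@sub_finite_set _ _ (tvars t `|` svars ts)).
  by move=> x /List.Exists_cons.
by rewrite finite_setU; split; [exact: finite_tvars | exact: IH].
Qed.

Lemma eq_seqsub ts s d :
  (forall x, svars ts x -> s x = d x) -> seqsub ts s = seqsub ts d.
Proof.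
elim: ts => [//|t ts IH] sd /=; congr cons.
  by apply: eq_tsub => x tx; apply: sd; apply/List.Exists_cons; left.
by apply: IH => x tx; apply: sd; apply/List.Exists_cons; right.
Qed.

Lemma tvars_tsub t s x :
  tvars (tsub t s) x -> exists2 y, tvars t y & tvars (s y) x.
Proof.
elim: t => [y|f a IH] /=; first by exists y.
by case=> i /IH[y ty sy]; exists y => //; exists i.
Qed.

Lemma svars_seqsub ts s x :
  svars (seqsub ts s) x -> exists2 y, svars ts y & tvars (s y) x.
Proof.
elim: ts => [/List.Exists_nil//|t ts IH] /List.Exists_cons[/tvars_tsub|/IH].
  by case=> y ty sy; exists y => //; apply/List.Exists_cons; left.
by case=> y ty sy; exists y => //; apply/List.Exists_cons; right.
Qed.

End Substitutions.

(** * Unification *)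

Section Unification.
Context {Sg : signature} {X : countType}.
Implicit Types (t r : term Sg X) (s d : subst Sg X).
Implicit Types (E : seq (term Sg X * term Sg X)).

Fixpoint tsize t : nat :=
  match t with
  | TVar _ => 1
  | App f a => (sumn [seq tsize (a i) | i <- enum 'I_(arity f)]).+1
  end.

Lemma tsize_gt0 t : 0 < tsize t.
Proof. by case: t. Qed.

Lemma tsize_arg (f : Sg) (a : 'I_(arity f) -> term Sg X) i :
  tsize (a i) < tsize (App a).
Proof.
rewrite /= ltnS sumnE big_map big_enum /=.
by rewrite (bigD1 i) //= leq_addr.
Qed.

Lemma tsize_var t s x : tvars t x -> tsize (s x) <= tsize (tsub t s).
Proof.
elim: t => [y ->//|f a IH] [i ti].
apply: leq_trans (IH i ti) (ltnW _).
exact: (tsize_arg (fun i => tsub (a i) s)).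
Qed.

(** The occurrence of [x] lies strictly below the root of [t], so [tsub t s] is larger than
    [s x]. *)
Lemma occurs_not_unifiable t s x :
  tvars t x -> t <> TVar x -> s x <> tsub t s.
Proof.
case: t => [y ->//|f a] [i ti] _ sx.
have := tsize_arg (fun i => tsub (a i) s) i.
by rewrite -[App _]/(tsub (App a) s) -sx ltnNge tsize_var.
Qed.

Lemma App_inj (f : Sg) (a c : 'I_(arity f) -> term Sg X) : App a = App c -> a = c.
Proof. by move=> ac; injection ac => /(@inj_pair2 _ _ _ _ _). Qed.

Definition sbind_fun (x : X) t : X -> term Sg X :=
  fun y => if y == x then t else TVar y.

Lemma sbind_finite x t : finite_set [set y | sbind_fun x t y <> TVar y].
Proof.
apply: (sub_finite_set _ (finite_set1 x)) => y /=.
by rewrite /sbind_fun; case: eqP.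
Qed.

Definition sbind x t : subst Sg X := Subst (sbind_finite x t).

(** A solution of [x = t] already carries out the binding and so absorbs it; eliminating [x]
    therefore loses no unifier. *)
Lemma sbind_scomp x t s : s x = tsub t s -> scomp (sbind x t) s = s.
Proof.
by move=> sx; apply: eq_subst => y /=; rewrite /sbind_fun; case: eqP => [->|].
Qed.

Lemma tsub_sbind_notin x t r : ~ tvars r x -> tsub r (sbind x t) = r.
Proof.
move=> rx; rewrite -[RHS]tsub_sid; apply: eq_tsub => y ry /=.
by rewrite /sbind_fun; case: eqP => // yx; rewrite yx in ry.
Qed.

Definition unifies E s := List.Forall (fun e => tsub e.1 s = tsub e.2 s) E.

Definition mgu_eqs E s :=
  unifies E s /\ forall d, unifies E d -> exists e, d = scomp s e.

Lemma unifies_cons l r E s :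
  unifies ((l, r) :: E) s <-> tsub l s = tsub r s /\ unifies E s.
Proof. exact: List.Forall_cons_iff. Qed.

Lemma unifies_cat E1 E2 s :
  unifies (E1 ++ E2) s <-> unifies E1 s /\ unifies E2 s.
Proof. exact: List.Forall_app. Qed.

Definition eqs_sub E s := [seq (tsub e.1 s, tsub e.2 s) | e <- E].

Lemma unifies_sub E s d : unifies (eqs_sub E s) d <-> unifies E (scomp s d).
Proof.
elim: E => [|[l r] E IH] /=; first by split=> _; constructor.
by rewrite !unifies_cons IH !tsub_scomp.
Qed.

Lemma unifies_args (f : Sg) (a c : 'I_(arity f) -> term Sg X) s :
  unifies [seq (a i, c i) | i <- enum 'I_(arity f)] s <->
  tsub (App a) s = tsub (App c) s.
Proof.
have -> : unifies [seq (a i, c i) | i <- enum 'I_(arity f)] s <->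
    forall i, i \in enum 'I_(arity f) -> tsub (a i) s = tsub (c i) s.
  elim: (enum _) => [|j e IH] /=; first by split=> // _; constructor.
  rewrite unifies_cons IH; split=> [[sj se] i|se].
    by rewrite inE => /predU1P[->//|/se].
  by split=> [|i ie]; apply: se; rewrite inE ?eqxx // ie orbT.
split=> [ac|/App_inj ac i _]; last by have := congr1 (@^~ i) ac.
by rewrite /=; congr App; apply: funext => i; apply: ac; rewrite mem_enum.
Qed.

(** Only left-hand sides are weighed: under a unifier both sides of an equation coincide. *)
Definition esize E s := sumn [seq tsize (tsub e.1 s) | e <- E].

(** The given unifier [s] guarantees the occurs check, so the binding solves [x = t]. Any unifier
    [d] absorbs the binding, hence factors through it followed by the mgu of the reduced system. *)
Lemma mgu_eqs_bind x t E s : t <> TVar x -> unifies ((TVar x, t) :: E) s ->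
  (exists e, mgu_eqs (eqs_sub E (sbind x t)) e) ->
  exists e, mgu_eqs ((TVar x, t) :: E) e.
Proof.
move=> tx /unifies_cons[/= sx _] [e [Ee e_min]].
have xt : ~ tvars t x by move=> xt; exact: (occurs_not_unifiable xt tx sx).
exists (scomp (sbind x t) e); split.
  apply/unifies_cons; split; last exact/unifies_sub.
  by rewrite !tsub_scomp (tsub_sbind_notin _ xt) /= /sbind_fun eqxx.
move=> d /unifies_cons[/= dx dE]; have bd := sbind_scomp dx.
have [|c dc] := e_min d; first by apply/unifies_sub; rewrite bd.
by exists c; rewrite -scompA -dc.
Qed.

(* The unifier [s] bounds the recursion: eliminating [x := t] leaves the
   [s]-instance of the other equations unchanged, because [s x = t s]. *)
Lemma exists_mgu_eqs E s : unifies E s -> exists e, mgu_eqs E e.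
Proof.
have [n] := ubnP (esize E s); elim: n E => // n IH [|[l r] E].
  by exists sid; split=> [|d _]; [constructor | exists d; rewrite scomp1s].
have bind x t : t <> TVar x -> esize E s < n -> unifies ((TVar x, t) :: E) s ->
    exists e, mgu_eqs ((TVar x, t) :: E) e.
  move=> tx ltE sE; apply: (mgu_eqs_bind tx sE).
  have /unifies_cons[/= sx sE'] := sE; have bs := sbind_scomp sx.
  apply: IH; last by apply/unifies_sub; rewrite bs.
  rewrite /esize -map_comp (eq_map (g := fun e => tsize (tsub e.1 s))) //.
  by move=> e /=; rewrite -tsub_scomp bs.
rewrite /esize /= ltnS => lt_n lrE.
have ltE : esize E s < n.
  by apply: leq_trans lt_n; rewrite -add1n leq_add2r tsize_gt0.
case: (pselect (l = r)) => [lr|].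
  subst r; have [|e [Ee e_min]] := IH _ ltE; first by have /unifies_cons[] := lrE.
  exists e; split; first by apply/unifies_cons.
  by move=> d /unifies_cons[_ /e_min].
case: l r lt_n lrE => [x|f a] [y|g c] lt_n lrE lr.
- by apply: bind => // yx; apply: lr.
- exact: bind.
(* The elimination case bounds [E] alone, so turning the first equation around costs nothing. *)
- have swap d : unifies ((TVar y, App a) :: E) d <->
      unifies ((App a, TVar y) :: E) d.
    by rewrite !unifies_cons; split=> -[-> ?].
  have [//|||e [Ee e_min]] := bind y (App a); [exact: ltE | exact/swap |].
  by exists e; split; [exact/swap | move=> d /swap/e_min].
have /unifies_cons[fg _] := lrE; case: (fg) => gf _; subst g.
have dec d : unifies ([seq (a i, c i) | i <- enum 'I_(arity f)] ++ E) d <->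
    unifies ((App a, App c) :: E) d.
  by rewrite unifies_cat unifies_cons unifies_args.
have [||e [Ee e_min]] := IH ([seq (a i, c i) | i <- enum 'I_(arity f)] ++ E).
(* Removing the common head symbol lowers the measure by exactly one. *)
- by move: lt_n; rewrite /esize map_cat sumn_cat -map_comp.
- exact/dec.
- by exists e; split; [exact/dec | move=> d /dec/e_min].
Qed.

Lemma exists_mgu t r s : tsub t s = tsub r s -> exists e, mgu tsub t r e.
Proof.
move=> tr; have [|e [/unifies_cons[er _] e_min]] := @exists_mgu_eqs [:: (t, r)] s.
  by apply/unifies_cons; split=> //; constructor.
exists e; split=> // d dtr; have [|c ->] := e_min d; last by exists c.
by apply/unifies_cons; split=> //; constructor.
Qed.

End Unification.

(** * Renaming apart *)

Section Renaming.
Context {X : countType}.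
Hypothesis X_infinite : infinite_set [set: X].

Lemma exists_fresh_seq (F : set X) n : finite_set F ->
  exists2 l : seq X, size l = n & uniq l /\ forall x, x \in l -> ~ F x.
Proof.
move=> finF; elim: n => [|n [l <- [ul lF]]]; first by exists [::].
have finG : finite_set (F `|` [set` l]).
  by rewrite finite_setU; split=> //; exact: finite_seq.
have [x _ Gx] : exists2 x, [set: X] x & ~ (F `|` [set` l]) x.
  apply: contrapT => noX; apply: X_infinite; apply: (sub_finite_set _ finG) => x _.
  by apply: contrapT => Gx; apply: noX; exists x.
exists (x :: l) => //; split=> /=.
  by rewrite ul andbT; apply/negP => xl; apply: Gx; right.
by move=> y; rewrite inE => /predU1P[->|/lF//] Fx; apply: Gx; left.
Qed.

(** Exchange an enumeration [w] of [W] with an equally long list [l] of variables outside [W] and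
    [V]; an exchange is its own inverse, hence bijective. *)
Lemma exists_renaming_apart (W V : set X) : finite_set W -> finite_set V ->
  exists2 f : X -> X, bijective f /\ finite_set [set x | f x <> x] &
    forall x, W x -> ~ V (f x).
Proof.
move=> finW finV; have /finite_seqP[w0 Ww0] := finW.
pose w := undup w0.
have Ww x : W x <-> x \in w by rewrite Ww0 mem_undup.
have finWV : finite_set (W `|` V) by rewrite finite_setU.
have [l szl [ul lWV]] := exists_fresh_seq (size w) finWV.
have uw : uniq w by exact: undup_uniq.
have lw x : x \in l -> (x \in w) = false.
  by move=> xl; apply/negP => /Ww xw; apply: (lWV _ xl); left.
(* Since [w] and [l] have the same length, the default [x] is never returned. *)
pose f x := if x \in w then nth x l (index x w)
            else if x \in l then nth x w (index x l) else x.
have fl x : x \in w -> f x \in l.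
  by move=> xw; rewrite /f xw mem_nth // szl index_mem.
exists f; last by move=> x /Ww/fl/lWV fx Vfx; apply: fx; right.
have fK : involutive f.
  move=> x; rewrite {2}/f; case: ifPn => [xw|xw].
    have xl : index x w < size l by rewrite szl index_mem.
    rewrite /f lw ?mem_nth // index_uniq //.
    by rewrite (set_nth_default x) -?szl // nth_index.
  case: ifPn => [xl|xl]; last by rewrite /f (negPf xw) (negPf xl).
  have xl' : index x l < size w by rewrite -szl index_mem.
  by rewrite /f mem_nth // index_uniq // (set_nth_default x) ?szl // nth_index.
split; first by exists f.
apply: (@sub_finite_set _ _ ([set` w] `|` [set` l])); last first.
  by rewrite finite_setU; split; exact: finite_seq.
by move=> x; rewrite /f /=; case: ifPn => [|_]; [left | case: ifPn; [right |]].
Qed.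

End Renaming.

(** * Instance steps *)

Section InstanceSteps.
Context {Sg : signature} {X : countType}.
Variable P : program Sg X.
Implicit Types (t u w : term Sg X) (s d th : subst Sg X) (v : option (term Sg X)).
Implicit Types (us vs ss S T : seq (term Sg X)).

Variant istep : seq (term Sg X) -> seq (term Sg X) -> Prop :=
| Istep u vs th ss of P (u, vs) : istep (tsub u th :: ss) (seqsub vs th ++ ss).

(** Once the rule is renamed apart from [S], its instantiation and [d] merge into one substitution
    [eta], which unifies the renamed head with the first term of [S]. The mgu factors [eta], and the
    second factor is [d']. *)
Lemma istep_lift (X_infinite : infinite_set [set: X]) S d T :
  istep (seqsub S d) T -> exists2 S', step P S S' & exists d', T = seqsub S' d'.
Proof.
move E: (seqsub S d) => S0 H; case: H E => u vs th ss Pr {S0 T}.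
case: S => [//|t S] [tu <-].
have finW : finite_set (rule_vars (u, vs)).
  by rewrite finite_setU; split; [exact: finite_tvars | exact: finite_svars].
have [f [bij_f finf] f_apart] :=
  exists_renaming_apart X_infinite finW (finite_svars (t :: S)).
have fin_g : finite_set [set x | TVar (f x) <> TVar x :> term Sg X].
  by apply: (sub_finite_set _ finf) => x /= gx fx; apply: gx; rewrite fx.
pose g := Subst fin_g.
have [h fK hK] := bij_f.
pose W := f @` rule_vars (u, vs).
(* On the renamed rule variables [eta] undoes the renaming and applies [th]; elsewhere it is [d]. *)
have eta_fin : finite_set
    [set x | (if `[< W x >] then th (h x) else d x) <> TVar x].
  apply: (@sub_finite_set _ _ (W `|` sdom d)).
    by move=> x /=; case: asboolP => [Wx _|_ dx]; [left | right].
  by rewrite finite_setU; split; [exact: finite_image | exact: sfun_finite].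
pose eta := Subst eta_fin.
have eta_g x : rule_vars (u, vs) x -> tsub (g x) eta = th x.
  by move=> xW /=; case: asboolP => [_|[]]; [rewrite fK | exists x].
have eta_S x : svars (t :: S) x -> eta x = d x.
  by move=> xS /=; case: asboolP => // -[y yW fy]; case: (f_apart y yW); rewrite fy.
have eta_u : tsub (tsub u g) eta = tsub u th.
  by rewrite -tsub_scomp; apply: eq_tsub => x ux; apply: eta_g; left.
have eta_vs : seqsub (seqsub vs g) eta = seqsub vs th.
  by rewrite -seqsub_scomp; apply: eq_seqsub => x ux; apply: eta_g; right.
have eta_tS : seqsub (t :: S) eta = seqsub (t :: S) d by exact: eq_seqsub.
have [eta_t eta_ss] : tsub t eta = tsub t d /\ seqsub S eta = seqsub S d.
  by case: eta_tS.
have [|e [e_u e_min]] := @exists_mgu _ _ (tsub u g) t eta.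
  by rewrite eta_u eta_t tu.
exists (seqsub (seqsub vs g ++ S) e).
  exists (u, vs) => //; apply: (@StepRule _ _ _ _ _ (tsub u g)) => //.
  split; do ?constructor.
  - by exists g => //; exists f.
  - apply/seteqP; split=> // x [gx Sx].
    have [y yW gy] : exists2 y, rule_vars (u, vs) y & tvars (g y) x.
      by case: gx => [/tvars_tsub|/svars_seqsub] [y ? ?]; exists y => //; [left|right].
    by case: (f_apart y yW); rewrite -gy.
have [|c etac] := e_min eta; first by rewrite eta_u eta_t tu.
exists c; rewrite -seqsub_scomp.
have -> : scomp e c = eta by apply: eq_subst => x; rewrite etac.
by rewrite [RHS]map_cat -!/(seqsub _ _) eta_vs eta_ss.
Qed.

(** * Soundness of binary and pattern rules *)

(* [R] is the transitive closure of [istep] for the rules of binunf and patunf,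
   and its reflexive transitive closure when the identity rules are allowed. *)
Definition rule_sound (R : relation (seq (term Sg X))) (u : term Sg X) v :=
  forall th ss, exists2 rest, (v = None -> rest = [::]) &
    R (tsub u th :: ss)
      (if v is Some w then tsub w th :: rest ++ ss else ss).

Notation isteps := (clos_refl_trans _ istep).
Notation istepp := (clos_trans _ istep).

Lemma istepp_isteps S T : istepp S T -> isteps S T.
Proof. exact: clos_t_clos_rt. Qed.

Lemma rule_soundW u v : rule_sound istepp u v -> rule_sound isteps u v.
Proof.
move=> H th ss; have [rest r0 /istepp_isteps] := H th ss.
by exists rest.
Qed.

Lemma rule_sound_id u : rule_sound isteps u (Some u).
Proof. by move=> th ss; exists [::] => //; exact: rt_refl. Qed.

Lemma rule_sound_sub R u v s :
  rule_sound R u v -> rule_sound R (tsub u s) (esub v s).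
Proof.
move=> H th ss; have [rest r0] := H (scomp s th) ss.
rewrite tsub_scomp => Hr; exists rest; first by case: v r0 {H Hr}.
by case: v H r0 Hr => //= w _ _; rewrite tsub_scomp.
Qed.

Lemma isteps_consume us th ss :
  List.Forall (fun u => rule_sound isteps u None) us ->
  isteps (seqsub us th ++ ss) ss.
Proof.
elim=> [|u {}us Hu _ IH] /=; first exact: rt_refl.
by have [_ _ /=] := Hu th (seqsub us th ++ ss) => H; exact: rt_trans H IH.
Qed.

Lemma istep_rt_t S T S' : istep S T -> isteps T S' -> istepp S S'.
Proof.
move=> ST TS'; elim/clos_refl_trans_ind_left: TS' => [|U V _ SU UV].
  exact: t_step.
exact: t_trans SU (t_step _ _ _ _ UV).
Qed.

Lemma rule_sound_fact u : P (u, [::]) -> rule_sound istepp u None.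
Proof. by move=> Pu th ss; exists [::] => //; apply: t_step; exact: (Istep th ss Pu). Qed.

(** A program step exposes the instantiated body; the rules with heads [us] consume its first terms,
    [(ui, v)] acts on the next one, and the tail [drop i vs] is added to what is left over. *)
Lemma rule_sound_unfold u vs i us ui v th :
  P (u, vs) -> (i < size vs -> v <> None) ->
  List.Forall (fun u => rule_sound isteps u None) us -> rule_sound isteps ui v ->
  seqsub (rcons us ui) th = seqsub (take i vs) th ->
  rule_sound istepp (tsub u th) (esub v th).
Proof.
move=> Pr iv Hus Hui Eth th' ss.
pose eta := scomp th th'.
have eqvs : seqsub vs eta = seqsub us eta ++ tsub ui eta :: seqsub (drop i vs) eta.
  rewrite -{1}(cat_take_drop i vs) /seqsub map_cat -!/(seqsub _ _).
  by rewrite seqsub_scomp -Eth -seqsub_scomp /seqsub map_rcons cat_rcons.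
have [rest r0 Hr] := Hui eta (seqsub (drop i vs) eta ++ ss).
exists (rest ++ seqsub (drop i vs) eta).
  (* If [v] is [e], then [i] is not below [size vs], so no tail of the body remains. *)
  case: v iv {Hui Hr} r0 => //= iv /(_ erefl) -> _.
  by rewrite drop_oversize //= leqNgt; apply/negP => /iv.
(* The program step makes the run non-empty even if the rules used after it are identities. *)
rewrite -tsub_scomp; apply: (istep_rt_t (Istep eta ss Pr)).
rewrite eqvs -catA cat_cons; apply: rt_trans (isteps_consume _ _ Hus) _.
move: Hr; case: v iv {Hui} r0 => [w _ _|iv r0] /=; first by rewrite -tsub_scomp -catA.
by rewrite drop_oversize // leqNgt; apply/negP => /iv.
Qed.

(** Identity rules take no step, so the premises of an unfolding are weakened to [isteps]; the
    program step of the unfolding restores [istepp]. *)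
Lemma binunf_sound (r : brule) : binunf P r -> rule_sound istepp r.1 r.2.
Proof.
case=> n _; elim: n r => [//|n IH] r /=.
have IH' r' : (iter n (Tbeta P) set0 `|` id_rules) r' ->
    rule_sound isteps r'.1 r'.2.
  by case=> [/IH/rule_soundW//|[f [x [_ ->]]]]; exact: rule_sound_id.
case=> -[r0 Hr0 [g _ ->]]; apply: rule_sound_sub.
  by case: Hr0 => u Pu ->; exact: rule_sound_fact.
case: Hr0 => u vs i us ui v th Pr _ _ [Hap _ _] iv [Eth _] /=.
move: Hap; rewrite -cats1 => /List.Forall_app[Hus /List.Forall_cons_iff[Hui _]].
apply: (rule_sound_unfold Pr iv _ _ Eth); last exact: (IH' _ Hui).
elim: us Hus {Eth} => [|w us IHus] /=; first by constructor.
by case/List.Forall_cons_iff => /IH' ? /IHus; constructor.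
Qed.

(** A left base term may be [e]; soundness includes that no left instance is. *)
Definition prule_sound (r : prule Sg X) :=
  forall n, exists2 t, pterm_at r.1 n = Some t &
    rule_sound istepp t (pterm_at r.2 n).

Lemma prule_sound_renaming (r r' : prule Sg X) : prule_sound r ->
  prule_rules r' `<=` epair_renamings (prule_rules r) -> prule_sound r'.
Proof.
move=> Hr sub n; have [|_ [m ->] [g _ [-> ->]]] := sub (pterm_at r'.1 n, pterm_at r'.2 n).
  by exists n.
have [t /= -> Ht] := Hr m; exists (tsub t g) => //; exact: rule_sound_sub.
Qed.

(** The [n]-th instance of a pattern unfolding is an ordinary unfolding of [n]-th instances with
    unifier [psubst_at (s, m) n]. *)
Lemma Tpi_unfold_sound (U : set (prule Sg X)) :
  (forall r, U r -> prule_sound r) ->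
  forall r, Tpi_unfold P U r -> prule_sound r.
Proof.
move=> HU _ [u vs i ps p v si mi s m Pr _ _ [Hap _ _] iv [_ Hmgu] ssi smi] n.
have {}HU r n' : (U `|` patid) r ->
    exists2 t, pterm_at r.1 n' = Some t & rule_sound isteps t (pterm_at r.2 n').
  case=> [/HU/(_ n')[t tr /rule_soundW Ht]|[f [x [_ ->]]]]; first by exists t.
  exists (tsub (App (fun i => TVar (x i))) (psubst_at (sid, sid) n')) => //.
  exact: rule_sound_id.
have [Eth _] := Hmgu n.
move: Hap; rewrite -cats1 => /List.Forall_app[Hps /List.Forall_cons_iff[Hp _]].
have [ui Eui Hui] := HU _ n Hp.
have [us Eus Hus] : exists2 us, [seq pterm_at q n | q <- ps] = map Some us &
    List.Forall (fun u => rule_sound isteps u None) us.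
  elim: ps Hps {Eth Hmgu} => [|q ps IH] /=; first by exists [::]; last constructor.
  case/List.Forall_cons_iff => /(HU _ n)[t tr Ht] /IH[us Eus Hus].
  by exists (t :: us); [rewrite /= tr Eus | constructor].
exists (tsub u (psubst_at (s, m) n)) => //=.
(* By commutation, [(si s)^n mi m = si^n s^n mi m = si^n mi s^n m]. *)
have -> : pterm_at (v, (scomp si s, scomp mi m)) n =
    esub (pterm_at (v, (si, mi)) n) (psubst_at (s, m) n).
  rewrite /pterm_at /psubst_at -esub_scomp /=; congr esub.
  have /commutesP sm := commutes_spow n smi.
  rewrite (spow_scomp _ (commutes_sym ssi)) -!scompA; congr scomp.
  by rewrite !scompA sm.
apply: (@rule_sound_unfold _ vs i us ui) => //.
  by move=> /iv; rewrite /pterm_at /=; case: (v).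
apply: (inj_map (@Some_inj _)).
move: Eth; rewrite map_rcons Eus Eui /= => Eth.
have hatE (w : term Sg X) : pterm_at (hat (Some w)) n = Some w.
  by rewrite /pterm_at /psubst_at /= scomps1 spow_sid tsub_sid.
have {}Eth : eseqsub (map Some (rcons us ui)) (psubst_at (s, m) n) =
    eseqsub (map Some (take i vs)) (psubst_at (s, m) n).
  rewrite map_rcons Eth -map_comp; congr eseqsub.
  by apply: eq_map => w; exact: hatE.
by move: Eth; rewrite /eseqsub /seqsub -!map_comp.
Qed.

Lemma patunf_sound (B : set (prule Sg X)) : correct P B ->
  forall r, patunf P B r -> prule_sound r.
Proof.
move=> HB r [n _]; elim: n r => [//|n IH] r /= [] [r' + sub].
- move=> /HB cr'; apply: prule_sound_renaming sub => m.
  have [|b /binunf_sound Hb [E1 E2]] := cr' (pterm_at r'.1 m, pterm_at r'.2 m).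
    by exists m.
  by exists b.1; rewrite ?E2.
- by move=> Hr'; apply: prule_sound_renaming sub; exact: (Tpi_unfold_sound IH Hr').
Qed.

(** * From infinite runs to infinite chains *)

Lemma infinite_chain_lift (X_infinite : infinite_set [set: X])
    (Q : set (seq (term Sg X))) :
  (forall S, Q S -> exists2 T, istepp S T & Q T) ->
  forall S, Q S -> infinite_chain_from P S.
Proof.
move=> HQ S0 QS0.
(* The invariant of the chain: some instance of [S] can still reach [Q]. Lifted steps preserve this,
   whereas the goals of the chain need not themselves return to [Q]. *)
pose live S := exists d, exists2 T, isteps (seqsub S d) T & Q T.
have live_step S : live S -> exists2 S', step P S S' & live S'.
  move=> [d [T ST QT]].
  have [S1 SS1 [T1 S1T1 QT1]] :
      exists2 S1, istep (seqsub S d) S1 & exists2 T, isteps S1 T & Q T.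
    (* The run to [T] may be empty; prolonging it by the non-empty run from [T] guarantees a first
       step to lift. *)
    have [S1 SS1 QS1] : exists2 T', istepp (seqsub S d) T' & Q T'.
      by have [T' TT' QT'] := HQ T QT; exists T' => //; exact: clos_rt_t ST TT'.
    move: SS1 => /(@clos_trans_t1n _ _ _ _) SS1.
    case: SS1 QS1 => [T' ST'|T' T'' ST' T'T''] QT'.
      by exists T' => //; exists T' => //; exact: rt_refl.
    by exists T' => //; exists T'' => //; apply: istepp_isteps; exact: clos_t1n_trans.
  have [S' SS' [d' ES1]] := istep_lift X_infinite SS1.
  by exists S' => //; exists d'; exists T1 => //; rewrite -ES1.
have live0 : live S0 by exists sid; exists S0 => //; rewrite seqsub_sid; exact: rt_refl.
(* Choice needs a total relation, so a goal that is not live is sent to itself; iteration from [S0]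
   never meets one. *)
have /choice[F HF] : forall S, exists S', live S -> step P S S' /\ live S'.
  move=> S; case: (pselect (live S)) => [/live_step[S' ? ?]|?]; first by exists S'.
  by exists S.
have liveF k : live (iter k F S0) by elim: k => //= k /HF[].
by exists (fun k => iter k F S0) => // k; have [] := HF _ (liveF k).
Qed.

End InstanceSteps.

(** * Infinite chains from a recurrent pattern rule *)

Theorem theorem3p13 (Sg : signature) (X : countType)
    (X_infinite : infinite_set [set: X])
    (P : program Sg X) (B : set (prule Sg X)) (B_correct : correct P B)
    (a b : nat) (u : term Sg X) (sigma mu sigma' mu' : subst Sg X)
    (comm_sigma : commutes sigma' sigma) (comm_mu : commutes sigma' mu)
    (in_patunf : patunf P B
       ((Some u, (sigma, mu)),
        (Some (tsub u (spow sigma a)),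
         (scomp (spow sigma b) sigma', scomp mu mu')))) :
  forall (n : nat) (theta : subst Sg X),
    infinite_chain_from P
      [:: tsub (tsub (tsub u (spow sigma n)) mu) theta].
Proof.
move=> n theta.
(* The exponent, the instance and the remaining goals may all change along the run; only the shape
   of the first term recurs. *)
pose Q := [set S | exists n theta rest,
  S = tsub (tsub (tsub u (spow sigma n)) mu) theta :: rest].
apply: (infinite_chain_lift X_infinite (Q := Q)); last by exists n, theta, [::].
move=> _ [k [th [ss ->]]].
have [_ [<-] /(_ th ss)[rest _]] := patunf_sound B_correct in_patunf k.
rewrite /pterm_at /= /psubst_at /= tsub_scomp => run.
eexists; first exact: run.
(* Moving [sigma'] past [sigma] and [mu] turns [u sigma^a (sigma^b sigma')^k mu mu' th] into
   [u sigma^(a + b k) mu (sigma'^k mu' th)]. *)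
exists (a + b * k), (scomp (spow sigma' k) (scomp mu' th)), (rest ++ ss).
congr cons; rewrite -!tsub_scomp; congr tsub.
have /commutesP sm := commutes_spow k comm_mu.
have comm_b := commutes_spow b (commutes_sym comm_sigma).
rewrite (spow_scomp _ comm_b) spowD spowM -!scompA; do 2! congr scomp.
by rewrite !scompA sm.
Qed.
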